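(* Consider the Ising channel with ternary alphabet $\mathcal{X}=\mathcal{Y}=\mathcal{S}=\{0,1,2\}$ (defined in the context), used with noiseless causal output feedback. Its feedback capacity is $$C_{fb} = \max_{p \in [0,1]} 2\,\frac{H_2(p) + 1-p}{p+3},$$ and numerically $C_{fb} \approx 0.961227$, attained at $p \approx 0.263805$.
   Context: The Ising channel with alphabet $\mathcal{X}$ is a finite-state channel with input $X_t\in\mathcal{X}$, output $Y_t\in\mathcal{X}$ and state $S_{t-1}\in\mathcal{X}$. At each time $t$, given the current input $x_t$, the state $s_{t-1}$ and all the past, the output is $Y_t=x_t$ with probability $1/2$ and $Y_t=s_{t-1}$ with probability $1/2$, independently of everything else. The state then updates as $S_t=X_t$. In particular, if $x_t=s_{t-1}$ then $Y_t=x_t$ with probability $1$. The initial state $s_0$ is known to both encoder and decoder. In the feedback setting, the encoder chooses $x_t$ as a function of the message and the past outputs $y^{t-1}=(y_1,\dots,y_{t-1})$. The feedback capacity $C_{fb}$ is the supremum of achievable rates, in bits per channel use, with vanishing error probability. $H_2(p)=-p\log_2 p-(1-p)\log_2(1-p)$ is the binary entropy function. *)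

(* Defs.v *)
From HB Require Import structures.
From mathcomp Require Import all_boot all_order all_algebra.
From mathcomp Require Import all_classical all_reals all_analysis.
Set Implicit Arguments. Unset Strict Implicit. Unset Printing Implicit Defensive.
Import Order.TTheory GRing.Theory Num.Theory.
Local Open Scope ring_scope.
Local Open Scope classical_set_scope.

Section Ising.
Variable R : realType.

Definition sym := 'I_3.

Definition ising_W (x s y : sym) : R :=
  (if y == x then 2^-1 else 0) + (if y == s then 2^-1 else 0).

(* Probability of the output string [ys] when the encoder (for a fixed
   message) maps past outputs to the next input, the current channel state
   is [s] and the outputs produced so far are [past].  The state is updated
   as S_t = X_t. *)
Fixpoint out_prob (enc : seq sym -> sym) (s : sym) (past ys : seq sym) : R :=
  match ys with
  | [::] => 1
  | y :: ys' => let x := enc past in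
                ising_W x s y * out_prob enc x (rcons past y) ys'
  end.

(* A feedback code of block length n with M messages:
   the input at time t is enc m (y_1, ..., y_{t-1}). *)
Record fb_code (n M : nat) := FbCode {
  fb_enc : 'I_M -> seq sym -> sym;
  fb_dec : n.-tuple sym -> 'I_M }.

Definition err_prob (s0 : sym) n M (c : fb_code n M) : R :=
  (M%:R)^-1 * \sum_(m : 'I_M) \sum_(y : n.-tuple sym | fb_dec c y != m)
      out_prob (fb_enc c m) s0 [::] (tval y).

Definition fb_achievable (s0 : sym) (r : R) : Prop :=
  forall eps : R, 0 < eps -> exists N : nat, forall n : nat, (N <= n)%N ->
    exists M : nat, exists c : fb_code n M,
      2 `^ (n%:R * r) <= M%:R /\ err_prob s0 c <= eps.

Definition fb_capacity (s0 : sym) : \bar R :=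
  ereal_sup [set r%:E | r in [set r : R | 0 <= r /\ fb_achievable s0 r]].

Definition xlog2 (x : R) : R := if x == 0 then 0 else x * ln x / ln 2.

Definition H2 (p : R) : R := - xlog2 p - xlog2 (1 - p).

Definition ising3_obj (p : R) : R := 2 * ((H2 p + 1 - p) / (p + 3)).

End Ising.

(* Main.v *)
Require Import Defs.
From HB Require Import structures.
From mathcomp Require Import all_boot all_order all_algebra.
From mathcomp Require Import all_classical all_reals all_analysis.
From mathcomp Require Import ring lra zify.
Set Implicit Arguments. Unset Strict Implicit. Unset Printing Implicit Defensive.
Import Order.TTheory GRing.Theory Num.Theory.
Local Open Scope ring_scope.

(** Let [q] be the root of [q^4 + 2 q^3 = 1] in (0,1), and [p0 = q^4]; by Gibbs'
inequality [p0] maximizes the objective, with value [-2 log2 q].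

Achievability: both parties know the state [s].  The encoder sends a letter [x];
an output other than [s] must be [x], and after an output equal to [s] the letter
is sent once more, which is then noiseless.  Repeating the state thus takes 2
channel uses, and any other letter 3/2 on average, so messages are coded by the
words of given mean duration [L/2] (up to a bounded excess): a prefix-free family
of at least [q^-L] words.  Errors only come from the fluctuation of the duration
around its mean.

Converse: let [Q] be the output law induced by this scheme under the optimal
letter distribution (up to a constant factor).  For any encoder the
log-likelihood ratio of its output law to [Q], corrected by a potential and by a
drift of [-2 ln q] per channel use, is a supermartingale with bounded increments,
and a second moment bound gives a strong converse. *)

(** * Output strings of a fixed encoder *)

Lemma big_tuple0 (R : nmodType) (T : finType) (F : seq T -> R) :
  \sum_(t : 0.-tuple T) F t = F [::].
Proof.
rewrite (big_pred1 [tuple]) // => t; apply/esym/eqP; exact: tuple0.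
Qed.

Lemma big_tupleS (R : nmodType) (T : finType) (n : nat) (F : seq T -> R) :
  \sum_(t : n.+1.-tuple T) F t = \sum_y \sum_(t : n.-tuple T) F (y :: t).
Proof.
rewrite pair_big (reindex (fun p : T * n.-tuple T => cons_tuple p.1 p.2)) //=.
exists (fun t : n.+1.-tuple T => (thead t, behead_tuple t)) => [[y t] _|t _] /=.
  by rewrite theadE; congr pair; apply: val_inj.
by case/tupleP: t => y t; apply: val_inj; rewrite /= theadE.
Qed.

Section Channel.
Variable R : realType.
Implicit Types (x y s : sym) (ys : seq sym) (f : seq sym -> sym).

Lemma ising_W_ge0 x s y : 0 <= ising_W R x s y.
Proof. by rewrite /ising_W addr_ge0 //; case: ifP => // _; rewrite invr_ge0. Qed.

Lemma sum_ising_W x s (F : sym -> R) :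
  \sum_y ising_W R x s y * F y = (F x + F s) / 2.
Proof.
under eq_bigr => y _ do rewrite /ising_W mulrDl.
have E z : \sum_y (if y == z then 2^-1 else 0) * F y = F z / 2.
  rewrite (bigD1 z) //= eqxx big1 ?addr0 1?mulrC // => y /negbTE ->.
  by rewrite mul0r.
by rewrite big_split /= !E mulrDl.
Qed.

(** The encoder is re-based after each output instead of carrying the past, so inductions on the
    string can generalize over [f]. *)
Fixpoint run_prob f s ys : R :=
  match ys with
  | [::] => 1
  | y :: ys' => ising_W R (f [::]) s y * run_prob (fun u => f (y :: u)) (f [::]) ys'
  end.

Lemma out_probE f s past ys :
  out_prob R f s past ys = run_prob (fun u => f (past ++ u)) s ys.
Proof.
have ext g h t us : g =1 h -> run_prob g t us = run_prob h t us.
  elim: us g h t => //= y us IH g h t gh; rewrite gh; congr (_ * _).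
  by apply: IH => u; rewrite gh.
elim: ys s past => //= y ys IH s past; rewrite cats0; congr (_ * _).
by rewrite IH; apply: ext => u; rewrite cat_rcons.
Qed.

Lemma run_prob_ge0 f s ys : 0 <= run_prob f s ys.
Proof. by elim: ys f s => //= y ys IH f s; rewrite mulr_ge0 ?ising_W_ge0. Qed.

(** First-step analysis: the first output is the input [f [::]] or the state [s], with probability
    1/2 each. *)
Lemma sum_run_probS n f s (F : seq sym -> R) :
  \sum_(t : n.+1.-tuple sym) run_prob f s t * F t =
  ((\sum_(t : n.-tuple sym)
      run_prob (fun u => f (f [::] :: u)) (f [::]) t * F (f [::] :: t)) +
   \sum_(t : n.-tuple sym)
      run_prob (fun u => f (s :: u)) (f [::]) t * F (s :: t)) / 2.
Proof.
rewrite (@big_tupleS _ _ _ (fun u => run_prob f s u * F u)) /=.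
under eq_bigr => y _ do
  (under eq_bigr => t _ do rewrite -mulrA; rewrite -mulr_sumr).
by rewrite sum_ising_W.
Qed.

Lemma sum_run_prob n f s : \sum_(t : n.-tuple sym) run_prob f s t = 1.
Proof.
elim: n f s => [|n IH] f s; first by rewrite big_tuple0.
have := @sum_run_probS n f s (fun=> 1).
under eq_bigr do rewrite mulr1.
under [X in _ = (X + _) / _]eq_bigr do rewrite mulr1.
under [X in _ = (_ + X) / _]eq_bigr do rewrite mulr1.
by rewrite !IH => ->; lra.
Qed.

End Channel.

(** * Converse *)

Section Converse.
Variables (R : realType) (kappa tau q : R).
Hypotheses (kappa_ge0 : 0 <= kappa) (kappa_le : kappa <= tau).
Hypotheses (qE : q = expR (- kappa)) (tauE : expR tau = 2).
Hypothesis q_root : q ^+ 4 + 2 * q ^+ 3 = 1.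
Implicit Types (x y s : sym) (ys : seq sym) (f : seq sym -> sym)
  (v : bool * sym).

(* A node [(u, z)] records the last output [z]; [u] holds when the scheme is
   about to resend, so that its state is not determined by the outputs. *)
Definition node_next v y : bool * sym := (~~ v.1 && (y == v.2), y).

(* [expR (- node_cost v y)] is the weight of output [y] at node [v]; the weights
   at a node need not sum to 1, but total masses stay bounded. *)
Definition node_cost v y : R :=
  if y == v.2 then if v.1 then 4 * kappa else 0 else 3 * kappa + tau.

(* Solves the Bellman equation of the dual problem; see [mean_gain]. *)
Definition potential v s : R :=
  if s == v.2 then if v.1 then 2 * kappa else 0 else kappa + tau.

(** Increment of the supermartingale: a bound on the log of the channel law, minus the log weight of
    [y], plus the change of potential, minus the drift. *)
Definition gain v s x y : R :=
  (if x == s then 0 else - tau) + node_cost v y + potential (node_next v y) x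
  - potential v s - 2 * kappa.

Fixpoint node_prob v ys : R :=
  match ys with
  | [::] => 1
  | y :: ys' => expR (- node_cost v y) * node_prob (node_next v y) ys'
  end.

Fixpoint score f s v ys : R :=
  match ys with
  | [::] => 0
  | y :: ys' => gain v s (f [::]) y +
                score (fun u => f (y :: u)) (f [::]) (node_next v y) ys'
  end.

Lemma node_prob_ge0 v ys : 0 <= node_prob v ys.
Proof. by elim: ys v => //= y ys IH v; rewrite mulr_ge0 ?expR_ge0. Qed.

Lemma potential_ge0 v s : 0 <= potential v s.
Proof.
by move: kappa_ge0 kappa_le; rewrite /potential; do 2?case: ifP => _; lra.
Qed.

Lemma ising_W_le x s y : ising_W R x s y <= expR (if x == s then 0 else - tau).
Proof.
rewrite /ising_W; case: (eqVneq x s) => [<-|xs].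
  by rewrite expR0; case: ifP => _; lra.
rewrite expRN tauE; case: (eqVneq y x) => [->|_]; last by case: ifP => _; lra.
by rewrite (negbTE xs); lra.
Qed.

(** The potentials telescope along the string; the final one is dropped, being nonnegative. *)
Lemma run_prob_le f s v ys :
  run_prob R f s ys <=
  node_prob v ys *
  expR (score f s v ys + 2 * kappa * (size ys)%:R + potential v s).
Proof.
elim: ys f s v => [|y ys IH] f s v /=.
  by rewrite mul1r add0r mulr0 add0r -expR0 ler_expR potential_ge0.
set x := f [::].
apply: le_trans (ler_pM (ising_W_ge0 _ _ _ _) (run_prob_ge0 _ _ _ _)
  (ising_W_le x s y) (IH (fun u => f (y :: u)) x (node_next v y))) _.
rewrite [leLHS]mulrCA [leRHS]mulrAC [leRHS]mulrC ler_wpM2l ?node_prob_ge0 //.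
rewrite -!expRD ler_expR /gain -[(size ys).+1%:R]natr1; lra.
Qed.

(** The two bounds reproduce themselves: [(1 + q^4) + 2 q^3 = 2] at a plain node and
    [2 q^4 + 2 q^3 = 1 + q^4] at a resend node. *)
Lemma node_prob_sum n v :
  \sum_(t : n.-tuple sym) node_prob v t <= if v.1 then 1 + q ^+ 4 else 2.
Proof.
have q4 : q ^+ 4 = expR (- (4 * kappa)) by rewrite qE -expRM_natl; congr expR; ring.
have q3 : q ^+ 3 / 2 = expR (- (3 * kappa + tau)).
  by rewrite qE -expRM_natl opprD expRD (expRN tau) tauE; congr (expR _ / _); lra.
have q4_gt0 : 0 < q ^+ 4 by rewrite q4 expR_gt0.
move: q_root => q1; elim: n v => [|n IH] [u s] /=.
  by rewrite (@big_tuple0 _ _ (node_prob (u, s))) /=; case: u; lra.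
rewrite (@big_tupleS _ _ _ (node_prob (u, s))) /=.
under eq_bigr do rewrite -mulr_sumr.
rewrite (bigD1 s) //=.
have le_other : \sum_(y | y != s) expR (- node_cost (u, s) y) *
    (\sum_(t : n.-tuple sym) node_prob (node_next (u, s) y) t) <= 2 * q ^+ 3.
  apply: le_trans (_ : \sum_(y : sym | y != s) q ^+ 3 <= _); last first.
    by rewrite sumr_const cardC1 card_ord mulr_natl.
  apply: ler_sum => y ys; rewrite /node_cost /= (negbTE ys) -q3.
  have := IH (node_next (u, s) y); rewrite /node_next /= (negbTE ys) andbF => H.
  have q3_gt0 : 0 < q ^+ 3 / 2 by rewrite q3 expR_gt0.
  by apply: le_trans (ler_wpM2l (ltW q3_gt0) H) _; lra.
have := IH (node_next (u, s) s).
rewrite /node_cost /node_next /= eqxx andbT.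
case: u le_other => /= le_other H.
  by rewrite -q4; have := ler_wpM2l (ltW q4_gt0) H; lra.
by rewrite oppr0 expR0 mul1r; lra.
Qed.

(** The sum is twice the expected gain. It vanishes if [x = s] or [s] is the letter of the node; the
    other cases use [0 <= kappa <= tau]. *)
Lemma mean_gain v s x : gain v s x x + gain v s x s <= 0.
Proof.
move: kappa_ge0 kappa_le => k0 kt; case: v => u z.
rewrite /gain /potential /node_cost /node_next /= ?eqxx.
case: (eqVneq x s) => [->|xs]; case: (eqVneq s z) => [sz|sz].
- by case: u => /=; lra.
- by case: u => /=; lra.
- by rewrite -sz (negbTE xs) ?eqxx; case: u => /=; lra.
- by case: u => /=; case: (eqVneq x z) => /= _; lra.
Qed.

Lemma gain_bound v s x y : `|gain v s x y| <= 10 * (kappa + tau).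
Proof.
move: kappa_ge0 kappa_le => k0 kt; case: v => u z.
rewrite /gain /potential /node_cost /node_next /= ler_norml.
by apply/andP; split; case: u => /=; do 4?case: ifP => _; lra.
Qed.

Lemma pos_sq_add (a x : R) :
  Num.max 0 (a + x) ^+ 2 <= Num.max 0 a ^+ 2 + 2 * Num.max 0 a * x + x ^+ 2.
Proof. by rewrite !maxEle; case: ifP => ?; case: ifP => ?; nra. Qed.

(** [a] is the score accumulated so far. In [pos_sq_add] the linear term has a nonnegative slope, so
    [mean_gain] removes it and only squared increments add up. *)
Lemma score_moment n f s v a :
  \sum_(t : n.-tuple sym) run_prob R f s t * Num.max 0 (a + score f s v t) ^+ 2
  <= Num.max 0 a ^+ 2 + n%:R * (10 * (kappa + tau)) ^+ 2.
Proof.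
elim: n f s v a => [|n IH] f s v a.
  rewrite (@big_tuple0 _ _
    (fun u => run_prob R f s u * Num.max 0 (a + score f s v u) ^+ 2)) /=.
  by rewrite mul1r mul0r !addr0.
rewrite (@sum_run_probS R n f s (fun u => Num.max 0 (a + score f s v u) ^+ 2)) /=.
set x := f [::].
under [X in (X + _) / _]eq_bigr => t _ do rewrite addrA.
under [X in (_ + X) / _]eq_bigr => t _ do rewrite addrA.
have Hx := IH (fun u => f (x :: u)) x (node_next v x) (a + gain v s x x).
have Hs := IH (fun u => f (s :: u)) x (node_next v s) (a + gain v s x s).
have M := mean_gain v s x.
have Bx := gain_bound v s x x; have Bs := gain_bound v s x s.
move: Hx Hs M Bx Bs; set X := gain v s x x; set S := gain v s x s.
have sq B (Z : R) : `|Z| <= B -> Z ^+ 2 <= B ^+ 2.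
  by move=> ZB; rewrite -real_normK ?num_real// ler_pXn2r ?nnegrE// (le_trans _ ZB).
move=> Hx Hs M /sq Bx /sq Bs.
have m0 : 0 <= Num.max 0 a by rewrite le_max lexx.
have PX := pos_sq_add a X; have PS := pos_sq_add a S.
have := mulr_ge0_le0 m0 M.
rewrite -[n.+1%:R]natr1 [(n%:R + 1) * _]mulrDl mul1r; lra.
Qed.

Lemma score_tail n f s v (theta : R) : 0 < theta ->
  \sum_(t : n.-tuple sym | theta < score f s v t) run_prob R f s t
  <= n%:R * (10 * (kappa + tau)) ^+ 2 / theta ^+ 2.
Proof.
move=> theta_gt0; rewrite ler_pdivlMr ?exprn_gt0 // mulr_suml.
have := @score_moment n f s v 0; rewrite maxxx expr0n add0r; apply: le_trans.
rewrite big_mkcond; apply: ler_sum => t _; case: ifP => [lt_t|_].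
  rewrite add0r ler_wpM2l ?run_prob_ge0 //.
  by rewrite ler_pXn2r ?nnegrE ?le_max ?lexx ?(ltW theta_gt0) ?(ltW lt_t) ?orbT.
by rewrite mulr_ge0 ?run_prob_ge0 // exprn_ge0 // le_max lexx.
Qed.

(** Unless the score is large, the output law is at most [E] times [node_prob], and the disjoint
    decoding regions share a total [node_prob] mass of at most 2. *)
Lemma success_le (s0 : sym) n M (c : fb_code n M) (theta : R) :
  (0 < M)%N -> 0 < theta ->
  1 - err_prob R s0 c <= n%:R * (10 * (kappa + tau)) ^+ 2 / theta ^+ 2
                         + 2 * expR (theta + 2 * kappa * n%:R) / M%:R.
Proof.
move=> M_gt0 theta_gt0; pose v := (false, s0); pose f m := fb_enc c m.
set T1 := _ / theta ^+ 2; set E := expR _.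
have M0 : 0 < M%:R :> R by rewrite ltr0n.
have split_sum m : \sum_(t : n.-tuple sym | fb_dec c t != m) out_prob R (f m) s0 [::] t
    = 1 - \sum_(t : n.-tuple sym | fb_dec c t == m) run_prob R (f m) s0 t.
  rewrite -(@sum_run_prob R n (f m) s0) [in RHS](bigID (fun t => fb_dec c t == m)) /=.
  by rewrite addrAC subrr add0r; apply: eq_bigr => t _; rewrite out_probE.
have -> : 1 - err_prob R s0 c = (\sum_m
    \sum_(t : n.-tuple sym | fb_dec c t == m) run_prob R (f m) s0 t) / M%:R.
  rewrite /err_prob; under eq_bigr do rewrite split_sum.
  rewrite sumrB sumr_const card_ord mulrBr mulVf ?lt0r_neq0 //.
  by rewrite opprB addrCA subrr addr0 mulrC.
have point m (t : n.-tuple sym) : run_prob R (f m) s0 t <=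
    (if theta < score (f m) s0 v t then run_prob R (f m) s0 t else 0)
    + node_prob v t * E.
  case: ltP => [_|le_t]; first by rewrite lerDl mulr_ge0 ?node_prob_ge0 ?expR_ge0.
  rewrite add0r; apply: le_trans (run_prob_le (f m) s0 v t) _.
  rewrite ler_wpM2l ?node_prob_ge0 // ler_expR size_tuple /potential eqxx /= addr0.
  by rewrite lerD2r.
rewrite ler_pdivrMr // mulrDl divfK ?lt0r_neq0 //.
apply: le_trans (_ : \sum_(m < M) T1 + (\sum_(t : n.-tuple sym) node_prob v t) * E <= _).
  have -> : (\sum_(t : n.-tuple sym) node_prob v t) * E =
      \sum_m \sum_(t : n.-tuple sym | fb_dec c t == m) node_prob v t * E.
    by rewrite mulr_suml (partition_big (fb_dec c) xpredT).
  rewrite -big_split /=; apply: ler_sum => m _.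
  apply: le_trans; first by apply: ler_sum => t _; apply: point.
  rewrite big_split /= lerD2r.
  apply: le_trans (score_tail n (f m) s0 v theta_gt0).
  rewrite -big_mkcondr [leRHS]big_mkcond [leLHS]big_mkcond /=.
  apply: ler_sum => t _; case: (fb_dec c t == m) => //=.
  by case: ifP => // _; exact: run_prob_ge0.
rewrite sumr_const card_ord -[_ *+ M]mulr_natr lerD2l ler_wpM2r ?expR_ge0 //.
exact: node_prob_sum.
Qed.

Lemma converse (s0 : sym) (r : R) : fb_achievable s0 r -> r * tau <= 2 * kappa.
Proof.
move=> ach; rewrite leNgt; apply/negP => gap.
(* With [theta = n d], the tail term is at most 1/4 once [n d^2 >= 4 B^2], and the mass term once
   [n d >= 8]; success probability 3/4 is then impossible. *)
pose d := (r * tau - 2 * kappa) / 2; pose B := 10 * (kappa + tau).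
have d_gt0 : 0 < d by rewrite /d; lra.
have [N HN] := ach (1 / 4) ltac:(lra).
have d8 : 0 <= 8 / d by rewrite divr_ge0 // ltW.
have dB : 0 <= 4 * B ^+ 2 / d ^+ 2 by rewrite divr_ge0 ?sqr_ge0 // mulr_ge0 // sqr_ge0.
have x0 : 0 <= 8 / d + 4 * B ^+ 2 / d ^+ 2.
  by rewrite addr_ge0.
have := archi_boundP x0; set K := Num.bound _ => HK.
pose n := (N + K)%N.
have [M [c [HM Herr]]] := HN n (leq_addr _ _).
have Kn : 8 / d + 4 * B ^+ 2 / d ^+ 2 < n%:R.
  by apply: lt_le_trans HK _; rewrite ler_nat leq_addl.
have n8 : 8 <= n%:R * d.
  by rewrite -ler_pdivrMr //; apply: le_trans (ltW Kn); rewrite lerDl.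
have nB : 4 * B ^+ 2 <= n%:R * d ^+ 2.
  by rewrite -ler_pdivrMr ?exprn_gt0 //; apply: le_trans (ltW Kn); rewrite lerDr.
have n_gt0 : 0 < n%:R :> R by nra.
have pw : 2 `^ (n%:R * r) = expR (n%:R * r * tau).
  by rewrite /powR pnatr_eq0 /= -tauE expRK.
have M_gt0 : 0 < M%:R :> R by apply: lt_le_trans HM; rewrite pw expR_gt0.
have th : 0 < n%:R * d by rewrite mulr_gt0.
have := success_le s0 c ltac:(by rewrite -(ltr0n R)) th.
rewrite -/B.
have H1 : n%:R * B ^+ 2 / (n%:R * d) ^+ 2 <= 1 / 4.
  rewrite ler_pdivrMr ?exprn_gt0 // [(n%:R * d) ^+ 2]exprMn.
  by move: (ler_wpM2l (ltW n_gt0) nB); move: (B ^+ 2) (d ^+ 2) (n%:R) => b e x; lra.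
have H2 : 2 * expR (n%:R * d + 2 * kappa * n%:R) / M%:R <= 1 / 4.
  rewrite ler_pdivrMr //; rewrite pw in HM.
  have -> : n%:R * d + 2 * kappa * n%:R = n%:R * r * tau + - (n%:R * d).
    by rewrite /d; lra.
  rewrite expRD expRN.
  have e8 : 8 <= expR (n%:R * d) by apply: le_trans (expR_ge1Dx _); lra.
  have e0 : 0 < expR (n%:R * d) by apply: expR_gt0.
  have : 2 / expR (n%:R * d) <= 1 / 4 by rewrite ler_pdivrMr //; lra.
  have := expR_ge0 (n%:R * r * tau); nra.
lra.
Qed.

End Converse.

(** * Achievability *)

Section Coding.
Implicit Types (x y s : sym) (w ys u : seq sym) (L : nat).

(** Twice the mean number of channel uses, to keep costs integral. *)
Definition step_cost s x : nat := if x == s then 4%N else 3%N.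

Fixpoint word_cost s w : nat :=
  if w is x :: w' then (step_cost s x + word_cost x w')%N else 0%N.

(** [u] lists the outputs since the start of [w], and [s] is the state at that moment. Once [w] is
    delivered, the state is sent as padding. *)
Fixpoint word_enc w s u : sym :=
  match w, u with
  | [::], _ => s
  | x :: _, [::] => x
  | x :: w', y :: u' =>
      if y != s then word_enc w' x u'
      else if u' is _ :: u'' then word_enc w' x u'' else x
  end.

Fixpoint decoded s w ys : bool :=
  match w, ys with
  | [::], _ => true
  | _ :: _, [::] => false
  | x :: w', y :: ys' =>
      if y != s then (y == x) && decoded x w' ys'
      else if ys' is y' :: ys'' then (y' == x) && decoded x w' ys'' else false
  end.

(** The word stops as soon as its cost reaches [L]; truncated subtraction absorbs the overshoot.
    Such words form a prefix-free family. *)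
Fixpoint complete L s w : bool :=
  match w with
  | [::] => L == 0%N
  | x :: w' => (0 < L)%N && complete (L - step_cost s x)%N x w'
  end.

Lemma decoded_inj L s w w' ys :
  complete L s w -> complete L s w' -> decoded s w ys -> decoded s w' ys -> w = w'.
Proof.
elim: w L s w' ys => [|x w IH] L s [|x' w'] ys //=.
- by move=> /eqP ->.
- by move=> /andP[] + _ /eqP L0; rewrite L0.
move=> /andP[_ Cw] /andP[_ Cw']; case: ys => // y ys.
case: ifP => _.
  move=> /andP[/eqP yx Dw] /andP[/eqP yx' Dw']; subst x x'.
  by congr cons; apply: IH Dw Dw'; eassumption.
case: ys => // y' ys /andP[/eqP yx Dw] /andP[/eqP yx' Dw']; subst x x'.
by congr cons; apply: IH Dw Dw'; eassumption.
Qed.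

Lemma complete_cost L s w : complete L s w -> (L <= word_cost s w <= L + 3)%N.
Proof.
(* The extra clause says that an exhausted budget leaves no cost, so only the last letter can
   overshoot, by at most 3. *)
have aux : forall w L s, complete L s w ->
    (L <= word_cost s w <= L + 3)%N && ((L == 0) ==> (word_cost s w == 0))%N.
  elim=> [|x {}w IH] {}L {}s /=; first by move=> /eqP ->.
  move=> /andP[L0 /IH]; rewrite /step_cost; case: ifP => _; lia.
by move=> /aux /andP[].
Qed.

Fixpoint words (k : nat) s L : seq (seq sym) :=
  if L == 0%N then [:: [::]]
  else if k is k'.+1 then
    [seq x :: w | x <- enum 'I_3, w <- words k' x (L - step_cost s x)%N]
  else [::].

Lemma words_complete k s L w : w \in words k s L -> complete L s w.
Proof.
elim: k s L w => [|k IH] s L w /=.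
  by case: ifP => // L0; rewrite inE => /eqP ->.
case: ifP => L0; first by rewrite inE => /eqP ->.
by move=> /allpairsPdep[x [w' [_ /IH Cw ->]]] /=; rewrite lt0n L0.
Qed.

Lemma words_uniq k s L : uniq (words k s L).
Proof.
elim: k s L => [|k IH] s L /=; case: ifP => // _.
apply: allpairs_uniq_dep; rewrite ?enum_uniq //.
by move=> [x w] [x' w'] _ _ /= [-> ->].
Qed.

(** A Kraft sum: after any state the letters have weights [q^4, q^3, q^3] of sum 1. A first letter
    overshooting the budget has weight at most [q^L]. *)
Lemma words_size (R : realFieldType) (q : R) k s L :
  0 < q <= 1 -> q ^+ 4 + 2 * q ^+ 3 = 1 -> (L <= k)%N ->
  1 <= (size (words k s L))%:R * q ^+ L.
Proof.
move=> /andP[q0 q1] qroot; elim: k s L => [|k IH] s L.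
  by rewrite leqn0 => /eqP -> /=; rewrite mulr1.
move=> Lk /=; case: eqP => [->|/eqP L0] /=; first by rewrite mulr1.
rewrite size_allpairs_dep sumnE big_map big_enum /= natr_sum mulr_suml.
have step x : q ^+ step_cost s x <=
    (size (words k x (L - step_cost s x)%N))%:R * q ^+ L.
  have c_gt0 : (0 < step_cost s x)%N by rewrite /step_cost; case: ifP.
  have /(IH x) H : (L - step_cost s x <= k)%N by lia.
  have c0 : 0 < q ^+ step_cost s x by rewrite exprn_gt0.
  case: (leqP (step_cost s x) L) => cL.
    by rewrite -{2}(subnK cL) exprD mulrA -[leLHS]mul1r ler_wpM2r // ltW.
  have -> : (L - step_cost s x = 0)%N by lia.
  have -> : words k x 0 = [:: [::]] by case: (k).
  by rewrite mul1r ler_wiXn2l ?(ltW q0) ?(ltnW cL).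
apply: le_trans (_ : \sum_x q ^+ step_cost s x <= _); last exact: ler_sum.
rewrite (bigD1 s) //= /step_cost eqxx.
under eq_bigr => x xs do rewrite (negbTE xs).
rewrite sumr_const cardC1 card_ord /=. by rewrite -[leLHS]qroot mulr_natl.
Qed.

End Coding.

(** * Failure probability of the scheme in a fixed block *)

Section Transmission.
Variable R : realType.
Implicit Types (x y s : sym) (w ys u : seq sym) (L n : nat).

Definition failure n w s : R :=
  \sum_(t : n.-tuple sym) run_prob R (word_enc w s) s t * (~~ decoded s w t)%:R.

Lemma failure_le1 n w s : failure n w s <= 1.
Proof.
rewrite -(@sum_run_prob R n (word_enc w s) s); apply: ler_sum => t _.
by case: decoded; rewrite ?mulr1 // mulr0 run_prob_ge0.
Qed.

Lemma failure_nil n s : failure n [::] s = 0.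
Proof. by rewrite /failure big1 // => t _; rewrite mulr0. Qed.

(** After the output [s] the state is already [x], so resending [x] succeeds surely in one more use,
    if one is left. *)
Lemma failure_resend n x w s :
  \sum_(t : n.-tuple sym) run_prob R (fun u => word_enc (x :: w) s (s :: u)) x t *
    (~~ decoded s (x :: w) (s :: t))%:R =
  if n is m.+1 then failure m w x else 1.
Proof.
case: n => [|m].
  rewrite (@big_tuple0 _ _
    (fun u => run_prob R _ x u * (~~ decoded s (x :: w) (s :: u))%:R)) /=.
  by rewrite eqxx mulr1.
rewrite (@sum_run_probS R m _ x (fun u => (~~ decoded s (x :: w) (s :: u))%:R)) /=.
by rewrite eqxx /= eqxx /= -/(failure m w x); lra.
Qed.

Lemma failure_cons n x w s :
  failure n.+1 (x :: w) s =
  let g := if n is m.+1 then failure m w x else 1 in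
  if x == s then g else (failure n w x + g) / 2.
Proof.
rewrite [LHS]/failure (@sum_run_probS R n _ s (fun u => (~~ decoded s (x :: w) u)%:R)).
rewrite [X in (_ + X) / 2](failure_resend n x w s); cbv zeta.
case: (eqVneq x s) => [->|xs].
  rewrite [X in (X + _) / 2](failure_resend n s w s).
  by set g := (if n is _.+1 then _ else _); lra.
congr ((_ + _) / 2); rewrite /= xs.
by apply: eq_bigr => t _; rewrite eqxx.
Qed.

(* Second moment bound: the right-hand side dominates [E (T - n + a)^2 / a^2] where
   [T] is the random transmission time of [w], whose mean is [word_cost s w / 2]
   and whose variance is at most [word_cost s w / 12]. *)
Lemma failure_le (a : R) n w s : 0 < a ->
  failure n w s <=
  ((word_cost s w)%:R / 12 + ((word_cost s w)%:R / 2 - n%:R + a) ^+ 2) / a ^+ 2.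
Proof.
move=> a0; rewrite ler_pdivlMr ?exprn_gt0 //.
elim: w s n => [|x w IH] s n.
  by rewrite failure_nil mul0r addr_ge0 ?sqr_ge0 ?divr_ge0.
set c := (word_cost x w)%:R : R.
have c0 : 0 <= c by rewrite ler0n.
have F1 k v z : failure k v z * a ^+ 2 <= a ^+ 2.
  by rewrite -[leRHS]mul1r ler_wpM2r ?sqr_ge0 // failure_le1.
case: n => [|n].
  apply: le_trans (F1 _ _ _) _; rewrite /= natrD -/c subr0.
  have : 0 <= (step_cost s x)%:R :> R by rewrite ler0n.
  by move: (step_cost s x)%:R => e e0; nra.
have Hn := IH x n; rewrite -/c in Hn.
have Hg : (if n is m.+1 then failure m w x else 1) * a ^+ 2 <=
    c / 12 + (c / 2 - (n%:R - 1) + a) ^+ 2.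
  case: n {Hn} => [|m]; first by rewrite mul1r; nra.
  by have := IH x m; rewrite -/c -[m.+1%:R]natr1 addrK.
rewrite failure_cons /= natrD -/c -[n.+1%:R]natr1 /step_cost.
move: Hn Hg; set A := failure n w x; set B := (if n is m.+1 then _ else _).
(* For [x != s] the duration is 1 or 2, with mean 3/2 and variance 1/4 = 3/12; for [x = s] it is
   exactly 2. *)
by case: ifP => _; move: (n%:R : R) A B => k A B; nra.
Qed.

Lemma words_code (s0 : sym) n L (q a : R) :
  0 < q <= 1 -> q ^+ 4 + 2 * q ^+ 3 = 1 ->
  0 < a -> n%:R = (L + 3)%:R / 2 + a ->
  exists M, exists c : fb_code n M,
    1 <= M%:R * q ^+ L /\
    err_prob R s0 c <= ((L + 3)%:R / 12 + 9 / 4) / a ^+ 2.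
Proof.
move=> q01 qroot a0 na; set B := _ / a ^+ 2.
pose ws := words L s0 L; pose M := size ws.
have sz : 1 <= M%:R * q ^+ L by apply: words_size.
have M0 : (0 < M)%N by case: (M) sz => //; rewrite mul0r; lra.
pose word (m : 'I_M) := nth [::] ws m.
have word_complete m : complete L s0 (word m).
  by apply: (@words_complete L); apply: mem_nth.
pose dec (t : n.-tuple sym) : 'I_M :=
  odflt (Ordinal M0) [pick m | decoded s0 (word m) t].
pose c := FbCode (fun m => word_enc (word m) s0) dec.
have decP m (t : n.-tuple sym) : decoded s0 (word m) t -> dec t = m.
  move=> D; rewrite /dec; case: pickP => [m' D'|/(_ m)]; last by rewrite D.
  apply/val_inj/eqP; rewrite /= -(nth_uniq [::] _ _ (words_uniq L s0 L)) //.
  by apply/eqP; apply: (decoded_inj (word_complete m') (word_complete m) D' D).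
exists M, c; split=> //.
have err m : \sum_(t : n.-tuple sym | dec t != m)
    out_prob R (word_enc (word m) s0) s0 [::] t <= B.
  apply: (@le_trans _ _ (failure n (word m) s0)).
    rewrite [leLHS]big_mkcond; apply: ler_sum => t _.
    rewrite out_probE; case: ifP => [dm|_].
      case: (boolP (decoded _ _ _)) => [/decP E|_]; last by rewrite mulr1.
      by rewrite E eqxx in dm.
    by rewrite mulr_ge0 ?run_prob_ge0.
  apply: le_trans (failure_le n (word m) s0 a0) _.
  rewrite ler_wpM2r ?invr_ge0 ?sqr_ge0 // na.
  (* The cost lies in [[L, L + 3]], so its half is within 3/2 of [(L + 3) / 2], whence 9/4. *)
  have /andP[] := complete_cost (word_complete m).
  rewrite -(ler_nat R) => lo; rewrite -(ler_nat R) => hi.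
  by move: lo hi; rewrite natrD; move: (word_cost _ _)%:R (L%:R) => k l; nra.
rewrite /err_prob mulrC ler_pdivrMr ?ltr0n //.
apply: (@le_trans _ _ (\sum_(m < M) B)); first by apply: ler_sum => m _; exact: err.
by rewrite sumr_const card_ord mulr_natr.
Qed.

End Transmission.

(** * Choice of the block parameters *)

Section Achievability.
Variables (R : realType) (kappa tau q : R).

Lemma achievability (s0 : sym) (r : R) :
  q = expR (- kappa) -> expR tau = 2 -> q ^+ 4 + 2 * q ^+ 3 = 1 ->
  0 <= r * tau < 2 * kappa -> fb_achievable s0 r.
Proof.
move=> qE tauE qroot /andP[r0 rk] eps eps0.
have k0 : 0 < kappa by lra.
(* A budget [n rho] yields [q^-(n rho) = 2^(n r)] words and takes [n rho / 2] uses on average,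
   leaving a fraction [sg] of the block as slack. *)
pose rho := r * tau / kappa; pose sg := (2 - rho) / 2.
have rho0 : 0 <= rho by rewrite divr_ge0 // ltW.
have rho2 : rho < 2 by rewrite ltr_pdivrMr.
have sg0 : 0 < sg by rewrite /sg; lra.
have sg1 : sg <= 1 by rewrite /sg; lra.
(* The first term gives [n sg >= 4], absorbing the rounding of [L]; the second makes
   [3 n / (n sg / 2)^2] at most [eps]. *)
have s4 : 0 <= 4 / sg by rewrite divr_ge0 // ltW.
have se : 0 <= 12 / (sg ^+ 2 * eps) by rewrite divr_ge0 // mulr_ge0 ?sqr_ge0 // ltW.
have x0 : 0 <= 4 / sg + 12 / (sg ^+ 2 * eps) by rewrite addr_ge0.
have := archi_boundP x0; set N := Num.bound _ => HN.
exists N => n Nn.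
have nx : 4 / sg + 12 / (sg ^+ 2 * eps) <= n%:R.
  by apply: le_trans (ltW HN) _; rewrite ler_nat.
have n4 : 4 <= n%:R * sg by rewrite -ler_pdivrMr //; lra.
have ne : 12 <= n%:R * (sg ^+ 2 * eps).
  by rewrite -ler_pdivrMr ?mulr_gt0 ?exprn_gt0 //; lra.
pose L := (Num.truncn (n%:R * rho)).+1.
have /andP[Lle Llt] := truncn_itv (mulr_ge0 (ler0n R n) rho0).
rewrite -/L in Llt.
have Lup : (L + 3)%:R <= n%:R * rho + 4.
  by rewrite addnC /L addnS -natr1 natrD; lra.
pose a := n%:R - (L + 3)%:R / 2 : R.
have a_ge : n%:R * sg / 2 <= a.
  have : n%:R * sg = n%:R - n%:R * rho / 2 by rewrite /sg; lra.
  by rewrite /a; lra.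
have a0 : 0 < a by lra.
have q01 : 0 < q <= 1 by rewrite qE expR_gt0 -expR0 ler_expR; lra.
have na : n%:R = (L + 3)%:R / 2 + a by rewrite /a; lra.
have [M [c [HM Herr]]] := words_code s0 q01 qroot a0 na.
exists M, c; split.
  apply: (@le_trans _ _ (expR (kappa * L%:R))).
    rewrite /powR pnatr_eq0 /= -tauE expRK ler_expR.
    have : n%:R * rho * kappa <= L%:R * kappa by rewrite ler_wpM2r ?ltW.
    by rewrite /rho -mulrA divfK ?lt0r_neq0 //; lra.
  move: HM; rewrite qE -expRM_natl mulrN expRN ler_pdivlMr ?expR_gt0 // mul1r.
  by rewrite mulrC.
apply: le_trans Herr _; rewrite ler_pdivrMr ?exprn_gt0 //.
have n1 : 1 <= n%:R :> R by nra.
have aa : (n%:R * sg / 2) ^+ 2 <= a ^+ 2.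
  by rewrite ler_pXn2r ?nnegrE ?(ltW a0) //; lra.
have top : (L + 3)%:R / 12 + 9 / 4 <= 3 * n%:R :> R.
  have : n%:R * rho <= n%:R * 2 by rewrite ler_wpM2l // ltW.
  by move: Lup n1; move: (_ * rho) ((L + 3)%:R) => u v; lra.
apply: le_trans top _.
apply: le_trans (_ : eps * (n%:R * sg / 2) ^+ 2 <= _); last by rewrite ler_wpM2l // ltW.
have -> : eps * (n%:R * sg / 2) ^+ 2 = n%:R * (n%:R * (sg ^+ 2 * eps)) / 4 by field.
have : n%:R * 12 <= n%:R * (n%:R * (sg ^+ 2 * eps)) by rewrite ler_wpM2l.
lra.
Qed.

End Achievability.

(** * The capacity in terms of the root *)

Lemma capacity_eq (R : realType) (kappa : R) (s0 : sym) :
  0 < kappa -> kappa <= ln 2 ->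
  expR (- kappa) ^+ 4 + 2 * expR (- kappa) ^+ 3 = 1 ->
  fb_capacity R s0 = (2 * kappa / ln 2)%:E.
Proof.
move=> k0 kt qroot; have tauE : expR (ln 2) = 2 :> R by rewrite lnK ?posrE.
have t0 : 0 < ln 2 :> R by lra.
apply/eqP; rewrite eq_le; apply/andP; split.
  apply: ge_ereal_sup => _ [r [r0 ach] <-]; rewrite lee_fin ler_pdivlMr //.
  exact: (converse (ltW k0) kt erefl tauE qroot ach).
apply/lee_subgt0Pr => e e0.
set C := 2 * kappa / ln 2.
have C0 : 0 < C by rewrite divr_gt0 // mulr_gt0.
(* The supremum ranges over nonnegative rates, hence the clipping at 0. *)
apply: (@le_trans _ _ (Num.max 0 (C - e))%:E).
  by rewrite -EFinB lee_fin le_max lexx orbT.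
apply: ereal_sup_ubound; exists (Num.max 0 (C - e)) => //; split.
  by rewrite le_max lexx.
apply: (achievability s0 erefl tauE qroot).
rewrite mulr_ge0 ?le_max ?lexx ?(ltW t0) //= -ltr_pdivlMr // -/C gt_max C0 /=.
by lra.
Qed.

(** * The maximizer *)

Lemma xlog2E (R : realType) (x : R) : xlog2 x = x * ln x / ln 2.
Proof. by rewrite /xlog2; case: eqP => // ->; rewrite !mul0r. Qed.

Lemma gibbs (R : realType) (x y : R) : 0 <= x -> 0 < y ->
  x * ln y - x * ln x <= y - x.
Proof.
move=> x0 y0; case: (eqVneq x 0) => [->|xn]; first by rewrite !mul0r; lra.
have xp : 0 < x by rewrite lt0r xn.
have yx : 0 < y / x by rewrite divr_gt0.
rewrite -mulrBr -ln_div ?posrE //.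
have := @le_ln1Dx R (y / x - 1) ltac:(lra); rewrite addrC subrK => H.
have := ler_wpM2l x0 H; rewrite mulrBr mulr1 mulrCA divff // mulr1; exact.
Qed.

Section Optimum.
Variables (R : realType) (kappa : R).
Let q := expR (- kappa).

Lemma objE (p : R) : ising3_obj p =
  2 * (- (p * ln p) - (1 - p) * ln (1 - p) + (1 - p) * ln 2) / (p + 3) / ln 2.
Proof.
have t0 : 0 < ln (2 : R) by rewrite ln_gt0 ?ltr1n.
rewrite /ising3_obj /H2 !xlog2E.
rewrite -!mulrA -[(_ + 3)^-1 * _]mulrC !mulrA.
congr (_ / _).
rewrite -!mulrA; congr (2 * _).
by field; rewrite lt0r_neq0.
Qed.

Lemma ln_q4 : ln (q ^+ 4) = - (4 * kappa).
Proof. by rewrite lnXn ?expR_gt0 // expRK; lra. Qed.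

Lemma ln_1Bq4 : q ^+ 4 + 2 * q ^+ 3 = 1 -> ln (1 - q ^+ 4) = ln 2 - 3 * kappa.
Proof.
move=> qroot; have -> : 1 - q ^+ 4 = 2 * q ^+ 3 by lra.
by rewrite lnM ?posrE ?exprn_gt0 ?expR_gt0 // lnXn ?expR_gt0 // expRK; lra.
Qed.

(** Gibbs' inequality against [(q^4, 1 - q^4)] bounds the entropy plus [(1 - p) ln 2] by
    [kappa (4 p + 3 (1 - p)) = kappa (p + 3)]. *)
Lemma obj_le p : q ^+ 4 + 2 * q ^+ 3 = 1 -> 0 <= p <= 1 ->
  ising3_obj p <= 2 * kappa / ln 2.
Proof.
move=> qroot /andP[p0 p1]; have t0 : 0 < ln (2 : R) by rewrite ln_gt0 ?ltr1n.
have q0 : 0 < q by exact: expR_gt0.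
have q4 : 0 < q ^+ 4 by rewrite exprn_gt0.
have q3 : 0 < q ^+ 3 by rewrite exprn_gt0.
rewrite objE ler_pM2r ?invr_gt0 // ler_pdivrMr; last lra.
have := gibbs p0 q4.
have := @gibbs R (1 - p) (1 - q ^+ 4) ltac:(lra) ltac:(lra).
rewrite (ln_1Bq4 qroot) ln_q4; lra.
Qed.

Lemma obj_eq : q ^+ 4 + 2 * q ^+ 3 = 1 -> ising3_obj (q ^+ 4) = 2 * kappa / ln 2.
Proof.
move=> qroot; have t0 : 0 < ln (2 : R) by rewrite ln_gt0 ?ltr1n.
have q0 : 0 < q by exact: expR_gt0.
have q4 : 0 < q ^+ 4 by rewrite exprn_gt0.
rewrite objE (ln_1Bq4 qroot) ln_q4; congr (_ / _); apply: (canLR (mulfK _)).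
  by rewrite lt0r_neq0 // addr_gt0.
lra.
Qed.

End Optimum.

(** * Numerical enclosure of the root and the rate *)

Section Numerics.
Variable R : realType.
Implicit Types (q a b c : R) (m e k j l : nat).

(** One Horner step on both exponents at once, [b] being the rounded bound. *)
Lemma pow_scale_ge q a b c m e k j l :
  0 <= a <= 2 ^+ m * q ^+ e -> 0 <= c <= q -> 0 <= b <= a ^+ k * 2 ^+ j * c ^+ l ->
  0 <= b <= 2 ^+ (m * k + j)%N * q ^+ (e * k + l)%N.
Proof.
move=> /andP[a0 aX] /andP[c0 cq] /andP[-> /le_trans->] //=.
rewrite !exprD !exprM mulrACA -exprMn -[leLHS]mulrA.
by rewrite !ler_pM ?mulr_ge0 ?exprn_ge0 ?lerXn2r ?nnegrE ?(le_trans c0 cq)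
  ?(le_trans a0 aX).
Qed.

Lemma pow_scale_le q a b c m e k j l :
  2 ^+ m * q ^+ e <= a -> 0 <= q <= c -> a ^+ k * 2 ^+ j * c ^+ l <= b ->
  2 ^+ (m * k + j)%N * q ^+ (e * k + l)%N <= b.
Proof.
move=> Xa /andP[q0 qc]; apply: le_trans.
have X0 : 0 <= 2 ^+ m * q ^+ e by rewrite mulr_ge0 ?exprn_ge0.
rewrite !exprD !exprM mulrACA -exprMn -[leRHS]mulrA.
by rewrite !ler_pM ?mulr_ge0 ?exprn_ge0 ?lerXn2r ?nnegrE ?(le_trans q0 qc)
  ?(le_trans X0 Xa).
Qed.

Lemma exp_lin (kappa : R) m e :
  2 ^+ m * expR (- kappa) ^+ e = expR (m%:R * ln 2 - e%:R * kappa).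
Proof.
by rewrite expRD !expRM_natl lnK ?posrE // -mulrN expRM_natl.
Qed.

Lemma quartic_root (a b : R) : a <= b ->
  a ^+ 4 + 2 * a ^+ 3 <= 1 -> 1 <= b ^+ 4 + 2 * b ^+ 3 ->
  exists2 q : R, a <= q <= b & q ^+ 4 + 2 * q ^+ 3 = 1.
Proof.
move=> ab a1 b1.
pose p : {poly R} := 'X^4 + 2%:P * 'X^3 - 1%:P.
have pE x : p.[x] = x ^+ 4 + 2 * x ^+ 3 - 1 by rewrite /p !hornerE.
have [|x xI] := @poly_ivt R p _ _ ab.
  by rewrite !pE; apply/andP; split; lra.
by move=> /rootP; rewrite pE => px; exists x => //; lra.
Qed.

(* Conversion between distinct large literals diverges, so [lo] and [hi] are
   kept as variables.  The bounds on [2^1661 q^3456] and [2^2851 q^5932] are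
   obtained by a Horner scheme in base 16 on the exponents, rounding at each step. *)
Lemma rate_bounds (kappa lo hi : R) :
  lo = 7166727492%:R / 10000000000%:R -> hi = 7166727493%:R / 10000000000%:R ->
  lo <= expR (- kappa) <= hi ->
  1661 / 3456 * ln 2 <= kappa <= 2851 / 5932 * ln 2.
Proof.
move=> loE hiE; set q := expR _ => /andP[lo_q q_hi].
have hi' : 0 <= q <= hi by rewrite expR_ge0.
have lo' : 0 <= lo <= q by rewrite lo_q andbT loE; lra.
have U0 : 2 ^+ 0 * q ^+ 0 <= 1 :> R by rewrite !expr0 mulr1.
have L0 : 0 <= (1 : R) <= 2 ^+ 0 * q ^+ 0 by rewrite !expr0 mulr1 ler01 lexx.
have U1 := @pow_scale_le q 1 (8420765236%:R / 10000000000%:R) hi 0 0 1 6 13 U0 hi'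
  ltac:(rewrite hiE; lra).
have U2 := @pow_scale_le q _ (5693797998%:R / 10000000000%:R) hi _ _ 16 7 8 U1 hi'
  ltac:(rewrite hiE; lra).
have U3 := @pow_scale_le q _ 1 hi _ _ 16 13 0 U2 hi' ltac:(rewrite hiE; lra).
have L1 := @pow_scale_ge q 1 (9631866370%:R / 10000000000%:R) lo 0 0 1 11 23 L0 lo'
  ltac:(rewrite loE; lra).
have L2 := @pow_scale_ge q _ (11273764338%:R / 10000000000%:R) lo _ _ 16 2 2 L1 lo'
  ltac:(rewrite loE; lra).
have L3 := @pow_scale_ge q _ 1 lo _ _ 16 3 12 L2 lo' ltac:(rewrite loE; lra).
move: U3 L3; rewrite /q !exp_lin => U3 /andP[_ L3].
have leE (x : R) : (expR x <= 1) = (x <= 0) by rewrite -expR0 ler_expR.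
have geE (x : R) : (1 <= expR x) = (0 <= x) by rewrite -expR0 ler_expR.
rewrite leE !(natrD, natrM) in U3; rewrite geE !(natrD, natrM) in L3.
by apply/andP; split; lra.
Qed.

End Numerics.

Theorem theorem3 (R : realType) (s0 : 'I_3) :
  exists p0 : R,
    [/\ 0 <= p0 <= 1,
        (forall p : R, 0 <= p <= 1 -> ising3_obj p <= ising3_obj p0),
        fb_capacity R s0 = (ising3_obj p0)%:E,
        `| ising3_obj p0 - 961227%:R / 1000000%:R | <= 5%:R / 10000000%:R
      & `| p0 - 263805%:R / 1000000%:R | <= 5%:R / 10000000%:R].
Proof.
have [lo loE] : exists x : R, x = 7166727492%:R / 10000000000%:R := ex_intro _ _ erefl.
have [hi hiE] : exists x : R, x = 7166727493%:R / 10000000000%:R := ex_intro _ _ erefl.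
have [q qI qroot] : exists2 q : R, lo <= q <= hi & q ^+ 4 + 2 * q ^+ 3 = 1.
  by apply: quartic_root; rewrite ?loE ?hiE; lra.
have /andP[lo_q q_hi] := qI.
have q_gt0 : 0 < q by apply: lt_le_trans lo_q; rewrite loE; lra.
pose kappa := - ln q.
have qE : expR (- kappa) = q by rewrite opprK lnK.
have t0 : 0 < ln (2 : R) by rewrite ln_gt0 ?ltr1n.
(* Doubled, these fractions are about 0.9612269 and 0.9612272, inside the required tolerance. *)
have /andP[klo khi] : 1661 / 3456 * ln 2 <= kappa <= 2851 / 5932 * ln 2.
  by apply: rate_bounds loE hiE _; rewrite qE.
have root_kappa : expR (- kappa) ^+ 4 + 2 * expR (- kappa) ^+ 3 = 1 by rewrite qE.
have objp0 := obj_eq root_kappa; rewrite qE in objp0.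
have p0lo : lo ^+ 4 <= q ^+ 4.
  by rewrite lerXn2r ?nnegrE ?(ltW q_gt0) // loE; lra.
have p0hi : q ^+ 4 <= hi ^+ 4.
  by rewrite lerXn2r ?nnegrE ?(ltW q_gt0) // (le_trans (ltW q_gt0) q_hi).
exists (q ^+ 4); split.
- by move: p0lo p0hi; rewrite loE hiE; lra.
- by move=> p pI; rewrite objp0 (obj_le root_kappa pI).
- by rewrite objp0; apply: capacity_eq root_kappa; lra.
- rewrite objp0 ler_norml lerBrDr lerBlDr ler_pdivlMr // ler_pdivrMr //.
  by apply/andP; split; lra.
- by rewrite ler_norml; move: p0lo p0hi; rewrite loE hiE; lra.
Qed.
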